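(* Let $(E,\mathcal{P})$ be an abstract network with capacities $c\in\mathbb{R}_+^E$, transit times $\tau\in\mathbb{Z}_+^E$ and time horizon $T\in\mathbb{Z}_+$. Then the value of a maximum abstract flow over time equals the capacity of a minimum abstract cut over time. Both a maximum abstract flow over time and a minimum abstract cut over time can be computed by solving a single (static) maximum weighted abstract flow problem.
   Context: Abstract network: a finite ground set $E$ and a family $\mathcal{P}\subseteq 2^E$ of nonempty sets called paths, each $P\in\mathcal{P}$ equipped with a linear order $<_P$ on its elements, satisfying the switching property: for all $P,Q\in\mathcal{P}$ and $e\in P\cap Q$ there is a path $P\times_e Q\in\mathcal{P}$ with $P\times_e Q\subseteq\{p\in P: p\le_P e\}\cup\{q\in Q: q\ge_Q e\}$ (no relation between the order of $P\times_e Q$ and those of $P,Q$ is required). Notation: for $P\in\mathcal{P}$ and $e\in P$, $(P,e):=\{p\in P: p<_P e\}$. Time expansion: $\mathcal{T}:=\{0,\dots,T-1\}$ and $E_T:=E\times\mathcal{T}$. For $P\in\mathcal{P}$ and $t\in\mathcal{T}$ the temporal path $P_t$ is identified with $\{(e,\theta)\in E_T: e\in P,\ \theta=t+\sum_{p\in(P,e)}\tau(p)\}$, and $\mathcal{P}_T:=\{P_t: P\in\mathcal{P},\ t\in\mathcal{T},\ t+\sum_{p\in P}\tau(p)<T\}$. An abstract flow over time is a map $x:\mathcal{P}_T\to\mathbb{R}_+$; it is feasible if $\sum_{P_t\in\mathcal{P}_T:\,(e,\theta)\in P_t}x(P_t)\le c(e)$ for all $e\in E$, $\theta\in\mathcal{T}$.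 Its value is $\sum_{P_t\in\mathcal{P}_T}x(P_t)$, and a maximum abstract flow over time is a feasible one of maximum value. An abstract cut over time is a set $C\subseteq E_T$ with $P_t\cap C\ne\emptyset$ for every $P_t\in\mathcal{P}_T$; its capacity is $\sum_{(e,\theta)\in C}c(e)$, and a minimum abstract cut over time is one of minimum capacity. (Static) maximum weighted abstract flow problem: given an abstract network $(E,\mathcal{P})$, capacities $c\in\mathbb{R}_+^E$ and a weight function $r\in\mathbb{R}_+^{\mathcal{P}}$ that is supermodular, i.e. $r(P\times_e Q)+r(Q\times_e P)\ge r(P)+r(Q)$ for all $P,Q\in\mathcal{P}$ and $e\in P\cap Q$, maximize $\sum_{P\in\mathcal{P}}r(P)x(P)$ subject to $\sum_{P\in\mathcal{P}:\,e\in P}x(P)\le c(e)$ for all $e\in E$ and $x(P)\ge 0$ for all $P\in\mathcal{P}$. Its linear programming dual, the minimum weighted abstract cut problem, is to minimize $\sum_{e\in E}c(e)y(e)$ subject to $\sum_{e\in P}y(e)\ge r(P)$ for all $P\in\mathcal{P}$ and $y(e)\ge 0$ for all $e\in E$. *)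

(* Defs.v *)
(* MathComp world; the reals are an arbitrary [R : realType]. *)
From mathcomp Require Import all_boot all_order all_algebra.
From mathcomp Require Import reals.

Set Implicit Arguments.
Unset Strict Implicit.
Unset Printing Implicit Defensive.

Import Order.TTheory GRing.Theory Num.Theory.
Local Open Scope ring_scope.

(* Raw data of an abstract network. [path_le N P] and [switch N P e Q] (the
   path P x_e Q) are only meaningful for P, Q \in paths N and e \in P :&: Q. *)
Record network (E : finType) := Network {
  paths : {set {set E}};
  path_le : {set E} -> rel E;
  switch : {set E} -> E -> {set E} -> {set E}
}.

Section Network.
Variables (E : finType) (N : network E).
Implicit Types (P Q : {set E}) (e : E).

Definition linear_order_on P (r : rel E) : Prop :=
  [/\ {in P, reflexive r}, {in P &, antisymmetric r},
      {in P & &, transitive r} & {in P &, total r}].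

Definition abstract_network : Prop :=
  [/\ forall P, P \in paths N -> P != set0,
      forall P, P \in paths N -> linear_order_on P (path_le N P)
    & forall P Q e, P \in paths N -> Q \in paths N -> e \in P :&: Q ->
        switch N P e Q \in paths N /\
        switch N P e Q \subset [set p in P | path_le N P p e]
                           :|: [set q in Q | path_le N Q e q]].

(* (P, e) *)
Definition before P e : {set E} :=
  [set p in P | (p != e) && path_le N P p e].

End Network.

Section Static.
Variables (R : realType) (E : finType) (N : network E).
Variables (c : E -> R) (r : {set E} -> R).

Definition supermodular : Prop :=
  forall P Q e, P \in paths N -> Q \in paths N -> e \in P :&: Q ->
    r (switch N P e Q) + r (switch N Q e P) >= r P + r Q.

Definition weighted_flow_instance : Prop :=
  [/\ abstract_network N, forall e, 0 <= c e,
      forall P, P \in paths N -> 0 <= r P & supermodular].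

(* Only the values of x on [paths N] matter. *)
Definition static_flow (x : {set E} -> R) : Prop :=
  (forall P, P \in paths N -> 0 <= x P) /\
  (forall e, \sum_(P in paths N | e \in P) x P <= c e).

Definition static_value (x : {set E} -> R) : R :=
  \sum_(P in paths N) r P * x P.

Definition max_weighted_flow (x : {set E} -> R) : Prop :=
  static_flow x /\ forall x', static_flow x' -> static_value x' <= static_value x.

Definition static_cut (y : E -> R) : Prop :=
  (forall P, P \in paths N -> r P <= \sum_(e in P) y e) /\
  (forall e, 0 <= y e).

Definition static_capacity (y : E -> R) : R := \sum_e c e * y e.

Definition min_weighted_cut (y : E -> R) : Prop :=
  static_cut y /\
  forall y', static_cut y' -> static_capacity y <= static_capacity y'.

End Static.

Section OverTime.
Variables (R : realType) (E : finType) (N : network E).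
Variables (c : E -> R) (tau : E -> nat) (T : nat).

Definition transit (P : {set E}) : nat := (\sum_(p in P) tau p)%N.

(* P_t *)
Definition temporal_path (P : {set E}) (t : nat) : {set E * 'I_T} :=
  [set z : E * 'I_T |
     (z.1 \in P) && (z.2 == t + transit (before N P z.1) :> nat)%N].

(* P_T *)
Definition temporal_paths : {set {set E * 'I_T}} :=
  [set temporal_path P (t : 'I_T)
     | P in paths N, t in [set: 'I_T] & (t + transit P < T)%N].

(* Only the values of x on [temporal_paths] matter. *)
Definition flow_over_time (x : {set E * 'I_T} -> R) : Prop :=
  (forall A, A \in temporal_paths -> 0 <= x A) /\
  (forall (e : E) (theta : 'I_T),
     \sum_(A in temporal_paths | (e, theta) \in A) x A <= c e).

Definition flow_value (x : {set E * 'I_T} -> R) : R :=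
  \sum_(A in temporal_paths) x A.

Definition max_flow_over_time (x : {set E * 'I_T} -> R) : Prop :=
  flow_over_time x /\
  forall x', flow_over_time x' -> flow_value x' <= flow_value x.

Definition cut_over_time (C : {set E * 'I_T}) : Prop :=
  forall A, A \in temporal_paths -> A :&: C != set0.

Definition cut_capacity (C : {set E * 'I_T}) : R := \sum_(z in C) c z.1.

Definition min_cut_over_time (C : {set E * 'I_T}) : Prop :=
  cut_over_time C /\
  forall C', cut_over_time C' -> cut_capacity C <= cut_capacity C'.

End OverTime.

(* The static instance. The natural weight T - tau(P) is supermodular but may
   be negative, while its truncation at 0 need not be supermodular. We therefore
   keep only the paths with tau(P) < T, prefix each of them with a new element
   [None] of transit time 0, and add the path {None} of weight 0, which replaces
   P x_e Q whenever tau(P x_e Q) >= T. The capacity of [None] is large enough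
   never to bind. *)
Section Reduction.
Variables (R : realType) (E : finType) (N : network E).
Variables (c : E -> R) (tau : E -> nat) (T : nat).

Definition lift_path (P : {set E}) : {set option E} := None |: Some @: P.

Definition base_path (A : {set option E}) : {set E} := [set e | Some e \in A].

Definition static_network : network (option E) := {|
  paths := [set None] |: lift_path @: [set P in paths N | (transit tau P < T)%N];
  path_le := fun A a b =>
    match a, b with
    | None, _ => true
    | Some _, None => false
    | Some p, Some q => path_le N (base_path A) p q
    end;
  switch := fun A a B =>
    match a with
    | None => B
    | Some e => let S := switch N (base_path A) e (base_path B) in
                if (transit tau S < T)%N then lift_path S else [set None]
    end
|}.

Definition static_cap (a : option E) : R :=
  if a is Some e then c e else 1 + \sum_e c e.

Definition static_weight (A : {set option E}) : R :=
  if A == [set None] then 0 else T%:R - (transit tau (base_path A))%:R.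

(* Sends x(P) units along P_t for every feasible starting time t; P is recovered
   from the set P_t as its projection to E. *)
Definition temporally_repeated (x : {set option E} -> R)
  (A : {set E * 'I_T}) : R := x (lift_path [set z.1 | z in A]).

(* { (e, theta) | alpha(e) <= theta < alpha(e) + y(e) }, where alpha(e) is the
   minimum of [delay y P e] over all P \in paths N containing e (including those
   with tau(P) >= T); elements on no path are left out. *)
Definition delay (y : option E -> R) (P : {set E}) (e : E) : R :=
  \sum_(p in before N P e) ((tau p)%:R + y (Some p)).

Definition threshold_cut (y : option E -> R) : {set E * 'I_T} :=
  [set z : E * 'I_T |
     [exists P in paths N, (z.1 \in P) && (delay y P z.1 <= (z.2)%:R)]
  && [forall P in paths N, (z.1 \in P) ==>
        ((z.2)%:R < delay y P z.1 + y (Some z.1))]].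

End Reduction.

(* Main.v *)
(* By linear programming duality, take an optimal static flow [x] and an optimal
   static cut [y] of the reduced instance, with equal values. Sending [x P] along
   [P_t] for all T - tau(P) feasible starting times [t] gives a flow over time of
   the same value. Measure lengths by tau + y: every path has length at least T,
   and paths carrying flow have length exactly T. Switching shows that the
   distance labels of the threshold cut are attained simultaneously along any
   path of length T, so that each of its temporal copies crosses the cut once;
   with complementary slackness the capacity of the threshold cut is the value
   of [x]. Switching also shows that no temporal path avoids the cut. *)
Require Import Defs.
From mathcomp Require Import all_boot all_order all_algebra.
From mathcomp Require Import boolp reals.
From mathcomp Require Import ring lra.
Import Order.TTheory GRing.Theory Num.Theory.
Local Open Scope ring_scope.
Set Implicit Arguments.
Unset Strict Implicit.
Unset Printing Implicit Defensive.

(** * Linear programming duality *)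

(* Induction on the number of forms: if [g] is positive at a point [u] of the
   cone of the remaining forms, then [a k u > 0], and one projects along [u]
   onto the kernel of [a k]. *)
Lemma farkas (R : realFieldType) (V : lmodType R) (K : eqType) (s : seq K)
    (a : K -> V -> R) (g : V -> R) :
  uniq s -> (forall k, scalar (a k)) -> scalar g ->
  (forall v, {in s, forall k, a k v <= 0} -> g v <= 0) ->
  exists2 l : K -> R, forall k, 0 <= l k &
    forall v, g v = \sum_(k <- s) l k * a k v.
Proof.
elim: s a g => [|k s IHs] a g /=.
  move=> _ _ gl g_le0; exists (fun=> 0) => // v; rewrite big_nil.
  apply/eqP; rewrite eq_le g_le0 //= -oppr_le0.
  have g0 : g 0 = 0 by have := gl (-1) 0 0; rewrite scaler0 addr0 mulN1r addNr.
  by have := gl (-1) v 0; rewrite g0 !addr0 mulN1r => <-; apply: g_le0.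
move=> /andP[ks us] al gl g_le0.
have [g_le0s|] := pselect (forall v, {in s, forall i, a i v <= 0} -> g v <= 0).
  have [l l0 gE] := IHs a g us al gl g_le0s.
  exists (fun i => if i == k then 0 else l i) => [i|v]; first by case: eqP.
  rewrite big_cons eqxx mul0r add0r gE; apply: eq_big_seq => i si.
  by case: eqP => // ik; rewrite -ik si in ks.
move=> /existsNP[u /not_implyP[au /negP]]; rewrite -ltNge => gu.
have ak_gt0 : 0 < a k u.
  rewrite ltNge; apply/negP => aku; move: gu; rewrite ltNge g_le0 // => i.
  by rewrite inE => /orP[/eqP->|/au].
pose pr f v : R := f v - a k v / a k u * f u.
have prE f : scalar f -> forall v, pr f v = f (- (a k v / a k u) *: u + v).
  by move=> fl v; rewrite fl mulNr addrC.
have prl f : scalar f -> scalar (pr f).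
  by move=> fl b v w; rewrite /pr fl al; ring.
have [||v apr|l l0 gE] := IHs (fun i => pr (a i)) (pr g) us.
- by move=> i; apply: prl.
- exact: prl.
- rewrite prE //; apply: g_le0 => i; rewrite inE => /orP[/eqP->|/apr].
    by rewrite al mulNr divfK ?gt_eqF // addNr.
  by rewrite prE.
(* The coefficient of [a k] is forced by evaluating the identity at [u]; it is nonnegative because
   [g u > 0], while the other forms are nonpositive at [u]. *)
pose lk := (g u - \sum_(j <- s) l j * a j u) / a k u.
exists (fun i => if i == k then lk else l i).
  move=> i; case: eqP => // _; apply: divr_ge0 (ltW ak_gt0).
  rewrite subr_ge0 (le_trans _ (ltW gu)) // big_seq.
  by apply: sumr_le0 => j sj; apply: mulr_ge0_le0 => //; apply: au.
move=> v; rewrite big_cons eqxx.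
have -> : \sum_(j <- s) (if j == k then lk else l j) * a j v =
    \sum_(j <- s) l j * a j v.
  by apply: eq_big_seq => i si; case: eqP => // ik; rewrite -ik si in ks.
have /eqP := gE v; rewrite /pr subr_eq => /eqP ->.
under eq_bigr do rewrite mulrBr [l _ * (_ * _)]mulrCA.
rewrite sumrB -mulr_sumr /lk; ring.
Qed.

(* Tucker's lemma: the multipliers that Farkas' lemma gives when [z k0 <= 0]
   throughout the cone are themselves a solution, since [w M w = 0]. *)
Lemma skew_complementarity (R : realFieldType) (K : finType) (M : K -> K -> R)
    (k0 : K) :
  (forall i j, M i j = - M j i) ->
  exists z : K -> R, [/\ forall k, 0 <= z k, forall k, 0 <= \sum_j M k j * z j
    & 0 < z k0 + \sum_j M k0 j * z j].
Proof.
move=> skew.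
pose Mz (z : K -> R) k := \sum_j M k j * z j.
have [[z [z0 Mz0 zk]]|noz] := pselect (exists z : K -> R,
  [/\ forall k, 0 <= z k, forall k, 0 <= Mz z k & 0 < z k0]).
  by exists z; split => //; apply: (ltr_wpDr (Mz0 k0)).
pose a (k : K + K) (z : {ffun K -> R^o}) : R :=
  match k with inl k => - z k | inr k => - Mz z k end.
have [||z az|l l0 lE] := @farkas R {ffun K -> R^o} (K + K)%type
    (enum {: K + K}) a (fun z => z k0) (enum_uniq _).
- case=> k b u v /=; rewrite ?ffunE; first by rewrite mulrN -opprD.
  rewrite /Mz mulrN -opprD mulr_sumr -big_split /=; congr (- _).
  by apply: eq_bigr => j _; rewrite !ffunE mulrDr mulrCA.
- by move=> b u v; rewrite !ffunE.
- rewrite leNgt; apply/negP => zk; apply: noz; exists z; split=> // k.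
    by have := az (inl k); rewrite mem_enum /= oppr_le0; apply.
  by have := az (inr k); rewrite mem_enum /= oppr_le0; apply.
pose p k := l (inl k); pose w k := l (inr k).
have {}lE (z : K -> R) : z k0 = - (\sum_k p k * z k) - \sum_k w k * Mz z k.
  have := lE (finfun z); rewrite big_enum big_sumType /= ffunE => ->.
  rewrite -!sumrN; congr (_ + _); apply: eq_bigr => k _; rewrite ?ffunE ?mulrN //.
  by congr (- (_ * _)); apply: eq_bigr => j _; rewrite ffunE.
(* Evaluate the identity at the indicator of [k]; skewness turns the column sum of [M] weighted by
   [w] into minus the row sum. *)
have MzE k : Mz w k = p k + (k0 == k)%:R.
  have := lE (fun j => (j == k)%:R).
  have sumd (f : K -> R) : \sum_j f j * (j == k)%:R = f k.
    by rewrite (bigD1 k) //= eqxx mulr1 big1 ?addr0 // => j /negPf ->; rewrite mulr0.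
  rewrite sumd; under eq_bigr do rewrite /Mz sumd skew mulrN mulrC.
  by rewrite sumrN opprK -/(Mz w k) => ->; rewrite addrA subrr add0r.
exists w; split=> [k|k|]; first exact: l0.
  by rewrite -/(Mz w k) MzE addr_ge0 ?l0.
by rewrite -/(Mz w k0) MzE eqxx addrA ltr_wpDl ?addr_ge0 ?l0.
Qed.

(** The mixed terms [y e * x P] cancel, so no feasibility is assumed. Weak duality and complementary
    slackness both follow from the signs of the summands. *)
Lemma duality_gap (R : realType) (E : finType) (N : network E) (c : E -> R)
    (r x : {set E} -> R) (y : E -> R) :
  static_capacity c y - static_value N r x =
    \sum_e y e * (c e - \sum_(P in paths N | e \in P) x P) +
    \sum_(P in paths N) x P * (\sum_(e in P) y e - r P).
Proof.
rewrite /static_capacity /static_value.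
under [X in _ = X + _]eq_bigr do rewrite mulrBr mulr_sumr.
under [X in _ = _ + X]eq_bigr do rewrite mulrBr mulr_sumr.
rewrite !sumrB (exchange_big_dep (mem (paths N))) /=; last by move=> ? ? _ /andP[].
have -> : \sum_(P in paths N) \sum_(e | (P \in paths N) && (e \in P)) y e * x P =
          \sum_(P in paths N) \sum_(e in P) x P * y e.
  by apply: eq_bigr => P ->; apply: eq_bigr => e _; rewrite mulrC.
rewrite addrA subrK; congr (_ - _); apply: eq_bigr => i _; exact: mulrC.
Qed.

Lemma weak_duality (R : realType) (E : finType) (N : network E) (c : E -> R)
    (r x : {set E} -> R) (y : E -> R) :
  static_flow N c x -> static_cut N r y ->
  static_value N r x <= static_capacity c y.
Proof.
move=> [x0 xc] [yr y0]; rewrite -subr_ge0 duality_gap.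
apply: addr_ge0; apply: sumr_ge0 => i iP; apply: mulr_ge0;
  by rewrite ?subr_ge0 ?x0 ?y0 ?yr.
Qed.

Lemma complementary_slackness (R : realType) (E : finType) (N : network E)
    (c : E -> R) (r x : {set E} -> R) (y : E -> R) :
  static_flow N c x -> static_cut N r y ->
  static_value N r x = static_capacity c y ->
  (forall e, 0 < y e -> \sum_(P in paths N | e \in P) x P = c e) /\
  (forall P, P \in paths N -> 0 < x P -> \sum_(e in P) y e = r P).
Proof.
move=> [x0 xc] [yr y0] xy.
have ge1 e : 0 <= y e * (c e - \sum_(P in paths N | e \in P) x P).
  by rewrite mulr_ge0 // subr_ge0.
have ge2 P : P \in paths N -> 0 <= x P * (\sum_(e in P) y e - r P).
  by move=> PN; rewrite mulr_ge0 ?x0 // subr_ge0 yr.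
have /eqP := duality_gap N c r x y.
rewrite xy subrr eq_sym paddr_eq0 ?sumr_ge0 // => /andP[/eqP s1 /eqP s2].
split=> [e ye | P PN xP].
  have /eqP : y e * (c e - \sum_(P in paths N | e \in P) x P) = 0.
    exact: (psumr_eq0P (fun i _ => ge1 i) s1).
  by rewrite mulf_eq0 gt_eqF //= subr_eq0 => /eqP.
have /eqP : x P * (\sum_(e in P) y e - r P) = 0 by apply: (psumr_eq0P ge2 s2).
by rewrite mulf_eq0 gt_eqF //= subr_eq0 => /eqP.
Qed.

(** Apply [skew_complementarity] to the self-dual homogenised system in [(s, y, x)], where [s]
    scales [c] and [r]; then divide by [s]. *)
Lemma strong_duality (R : realType) (E : finType) (N : network E) (c : E -> R)
    (r : {set E} -> R) :
  (forall P, P \in paths N -> P != set0) -> (forall e, 0 <= c e) ->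
  exists x y, [/\ static_flow N c x, static_cut N r y
    & static_value N r x = static_capacity c y].
Proof.
move=> N0 c0.
(* The index type contains every set; the sets that are not paths get zero coefficients. *)
pose A e P : R := ((P \in paths N) && (e \in P))%:R.
pose r' P := if P \in paths N then r P else 0.
pose M (i j : 'I_1 + (E + {set E})) : R :=
  match i, j with
  | inl _, inr (inl e) => - c e | inr (inl e), inl _ => c e
  | inl _, inr (inr P) => r' P | inr (inr P), inl _ => - r' P
  | inr (inl e), inr (inr P) => - A e P | inr (inr P), inr (inl e) => A e P
  | _, _ => 0
  end.
have [|z [z0 Mz0 z1]] := @skew_complementarity R _ M (inl ord0).
  by case=> [?|[?|?]] [?|[?|?]] /=; rewrite ?oppr0 ?opprK.
pose s := z (inl ord0); pose y e := z (inr (inl e)); pose x P := z (inr (inr P)).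
have sumE k : \sum_j M k j * z j =
    M k (inl ord0) * s + (\sum_e M k (inr (inl e)) * y e +
    \sum_P M k (inr (inr P)) * x P).
  by rewrite !big_sumType big_ord1.
have xc e : \sum_(P in paths N | e \in P) x P <= c e * s.
  have := Mz0 (inr (inl e)); rewrite sumE /= big1 => [|? _]; last by rewrite mul0r.
  rewrite add0r; under eq_bigr do rewrite mulNr.
  rewrite sumrN subr_ge0; apply: le_trans; rewrite big_mkcond /=.
  by apply: ler_sum => P _; rewrite /A; case: ifP; rewrite ?mul1r ?mul0r.
have yr P : P \in paths N -> r P * s <= \sum_(e in P) y e.
  move=> PN; have := Mz0 (inr (inr P)).
  rewrite sumE /= [X in _ + (_ + X)]big1 => [|? _]; last by rewrite mul0r.
  rewrite addr0 mulNr addrC subr_ge0 /r' PN => /le_trans; apply.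
  rewrite [leRHS]big_mkcond /=.
  by apply: ler_sum => e _; rewrite /A PN /=; case: ifP; rewrite ?mul1r ?mul0r.
have valE : \sum_j M (inl ord0) j * z j = static_value N r x - static_capacity c y.
  rewrite sumE /= mul0r add0r addrC; congr (_ + _).
    rewrite /static_value [RHS]big_mkcond; apply: eq_bigr => P _ /=.
    by rewrite /r'; case: ifP; rewrite ?mul0r.
  by rewrite -sumrN; apply: eq_bigr => e _; rewrite mulNr.
have y0 e : 0 <= y e by apply: z0.
have x0 P : 0 <= x P by apply: z0.
(* If [s = 0], the capacity constraints kill [x] on the nonempty paths, so value minus capacity is
   nonpositive, against the strict inequality [z1]. *)
have := z0 (inl ord0); rewrite -/s le_eqVlt => /orP[/eqP s0|s_gt0].
  move: z1; rewrite valE -/s -s0 add0r subr_gt0 ltNge => /negP[].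
  rewrite [leLHS]big1 ?sumr_ge0 // => [e _|P PN]; first exact: mulr_ge0.
  suff -> : x P = 0 by rewrite mulr0.
  have /set0Pn[e eP] := N0 _ PN; have := xc e; rewrite -s0 mulr0 => le0.
  apply/eqP; rewrite eq_le x0 andbT; apply: le_trans le0.
  by rewrite (bigD1 P) /= ?PN // lerDl sumr_ge0.
have [xf yf] : static_flow N c (fun P => x P / s) /\ static_cut N r (fun e => y e / s).
  split; split=> [P PN|e]; rewrite ?divr_ge0 ?(ltW s_gt0) //.
    by rewrite -mulr_suml ler_pdivrMr.
  by rewrite -mulr_suml ler_pdivlMr // yr.
exists (fun P => x P / s), (fun e => y e / s); split=> //.
apply/eqP; rewrite eq_le (weak_duality xf yf) /=.
have := Mz0 (inl ord0); rewrite valE subr_ge0 /static_value /static_capacity => le.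
under eq_bigr do rewrite mulrA.
under [leRHS]eq_bigr do rewrite mulrA.
by rewrite -!mulr_suml ler_pM2r ?invr_gt0.
Qed.

(** * Switching and the static instance *)

(** An element of [S] with the fewest predecessors in [P] is least. *)
Lemma linear_order_min (E : finType) (P S : {set E}) (r : rel E) :
  linear_order_on P r -> S \subset P -> S != set0 ->
  exists2 f, f \in S & {in S, forall g, r f g}.
Proof.
move=> [refl anti trans tot] /subsetP SP /set0Pn[f0 f0S].
pose below e := [set p in P | (p != e) && r p e].
case: (arg_minnP (fun e => #|below e|) f0S) => f fS fmin.
exists f => // g gS; have [fP gP] := (SP f fS, SP g gS).
have /orP[//|rgf] := tot f g fP gP.
have [-> //|gf] := eqVneq g f; first exact: refl.
have := fmin g gS; rewrite leqNgt => /negP[]; apply: proper_card.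
apply/properP; split; last by exists g; rewrite !inE ?gP ?gf ?eqxx.
apply/subsetP => p; rewrite !inE => /and3P[pP pg rpg]; rewrite pP /=.
rewrite (trans g p f) // andbT; apply/eqP => pf; case/eqP: gf.
by apply: anti => //; rewrite rgf -{1}pf.
Qed.

Lemma linear_order_converse (E : finType) (P : {set E}) (r : rel E) :
  linear_order_on P r -> linear_order_on P (fun a b => r b a).
Proof.
move=> [refl anti trans tot]; split=> //.
- by move=> a b aP bP /andP[ab ba]; apply: anti => //; rewrite ab ba.
- by move=> b a d bP aP dP ba db; apply: (trans b).
- by move=> a b aP bP; rewrite orbC; apply: tot.
Qed.

Lemma sumr_subset (R : numDomainType) (E : finType) (F : E -> R)
    (A B : {set E}) :
  (forall e, 0 <= F e) -> A \subset B ->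
  \sum_(e in A) F e <= \sum_(e in B) F e.
Proof.
move=> F0 /setIidPr AB.
by rewrite [leRHS](big_setID A) /= AB lerDl sumr_ge0.
Qed.

(** * Prefixes of paths and sums along switched paths *)

Section Before.
Variables (E : finType) (N : network E).
Implicit Types (P Q : {set E}) (e f : E).
Hypothesis hN : abstract_network N.

Lemma before_first P : P \in paths N ->
  exists2 e, e \in P & before N P e = set0.
Proof.
move=> PN; have [ne lin _] := hN.
have [e eP emin] := linear_order_min (lin _ PN) (subxx P) (ne _ PN).
exists e => //; apply/setP => p; rewrite !inE.
have [_ anti _ _] := lin _ PN.
apply/negP => /and3P[pP /eqP pe ple]; apply: pe.
by apply: anti => //; rewrite ple emin.
Qed.

Lemma notin_before P e : e \notin before N P e.
Proof. by rewrite inE eqxx andbF. Qed.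

Lemma before_sub P e : before N P e \subset P.
Proof. by apply/subsetP => p; rewrite inE => /andP[]. Qed.

Lemma upto_before P e f : P \in paths N -> e \in P -> f \in P -> e != f ->
  Defs.path_le N P e f -> e |: before N P e \subset before N P f.
Proof.
move=> PN eP fP ef ref; have [_ lin _] := hN.
have [_ anti trans _] := lin _ PN.
apply/subsetP => p; rewrite !inE => /predU1P[->|/and3P[pP pe rpe]].
  by rewrite eP ef.
rewrite pP (trans e) // andbT; apply/eqP => pf.
by move/eqP: ef => []; apply: anti => //; rewrite ref -pf.
Qed.

(** Here [e] belongs to the [Q] part only, so that sums count it once. *)
Lemma switch_sub P Q e : P \in paths N -> Q \in paths N -> e \in P ->
    e \in Q ->
  switch N P e Q \subset before N P e :|: (Q :\: before N Q e).
Proof.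
move=> PN QN eP eQ; have [_ lin sw] := hN.
have [|_ sub] := sw P Q e PN QN; first by rewrite inE eP.
have [_ anti trans tot] := lin _ QN.
apply: subset_trans sub _; apply/subsetP => p; rewrite !inE.
have [->|pe] := eqVneq p e; first by rewrite eQ !andbF.
case/orP => [/andP[-> ->]//|/andP[pQ lep]]; rewrite pQ /= andbT.
apply/orP; right; apply/negP => lpe; case/eqP: pe.
by apply: anti => //; rewrite lep lpe.
Qed.

Lemma sum_upto (R : numDomainType) (F : E -> R) P e :
  \sum_(p in e |: before N P e) F p = \sum_(p in before N P e) F p + F e.
Proof. by rewrite big_setU1 ?notin_before //= addrC. Qed.

Lemma sum_before_lt (R : numDomainType) (F : E -> R) P e f :
  (forall p, 0 <= F p) -> P \in paths N -> e \in P -> f \in P -> e != f ->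
  Defs.path_le N P e f ->
  \sum_(p in before N P e) F p + F e <= \sum_(p in before N P f) F p.
Proof.
by move=> F0 PN eP fP ef lef; rewrite -sum_upto sumr_subset ?upto_before.
Qed.

Lemma sum_before_path (R : numDomainType) (F : E -> R) P e :
  (forall p, 0 <= F p) -> e \in P ->
  \sum_(p in before N P e) F p + F e <= \sum_(p in P) F p.
Proof.
by move=> F0 eP; rewrite -sum_upto sumr_subset // subUset sub1set eP before_sub.
Qed.

(** Only an inequality, as the switched path may omit elements. Used with [tau] for supermodularity
    and with [tau + y] for comparing delays. *)
Lemma sum_switch (R : numDomainType) (F : E -> R) P Q e :
  (forall p, 0 <= F p) -> P \in paths N -> Q \in paths N -> e \in P ->
  e \in Q ->
  \sum_(p in switch N P e Q) F p + \sum_(p in before N Q e) F p <=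
  \sum_(p in before N P e) F p + \sum_(p in Q) F p.
Proof.
move=> F0 PN QN eP eQ.
have : \sum_(p in switch N P e Q) F p <=
    \sum_(p in before N P e) F p + \sum_(p in Q :\: before N Q e) F p.
  apply: le_trans (sumr_subset F0 (switch_sub PN QN eP eQ)) _.
  rewrite (big_setID (before N P e)) /= setUK.
  rewrite lerD2l sumr_subset //.
  by rewrite setDUl setDv set0U subDset subsetUr.
move=> le1; rewrite [\sum_(p in Q) F p](big_setID (before N Q e)) /=.
rewrite (setIidPr (before_sub Q e)) addrCA [leLHS]addrC.
by rewrite lerD2l.
Qed.

End Before.

(** * The reduced instance is a weighted abstract flow instance *)

Section StaticNetwork.
Variables (R : realType) (E : finType) (N : network E).
Variables (tau : E -> nat) (T : nat).
Implicit Types (P Q : {set E}) (e f : E).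
Hypothesis hN : abstract_network N.

Lemma None_in_lift P : None \in lift_path P.
Proof. exact: setU11. Qed.

Lemma Some_in_lift P e : (Some e \in lift_path P) = (e \in P).
Proof. by rewrite !inE /= mem_imset //; apply: Some_inj. Qed.

Lemma lift_pathK : cancel (@lift_path E) (@base_path E).
Proof. by move=> P; apply/setP => e; rewrite inE Some_in_lift. Qed.

Lemma sum_lift (F : option E -> R) P :
  \sum_(a in lift_path P) F a = F None + \sum_(e in P) F (Some e).
Proof.
rewrite big_setU1 ?big_imset //=; first by move=> ? ? _ _ [].
by apply/imsetP => [[]].
Qed.

Lemma lift_path_neq P : P != set0 -> lift_path P != [set None].
Proof.
case/set0Pn => e eP; apply/eqP => /setP/(_ (Some e)).
by rewrite Some_in_lift eP !inE.
Qed.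

Lemma transitE P : (transit tau P)%:R = \sum_(p in P) (tau p)%:R :> R.
Proof. exact: natr_sum. Qed.

Lemma static_weight_lift P : P != set0 ->
  static_weight R tau T (lift_path P) = T%:R - \sum_(p in P) (tau p)%:R.
Proof.
by move=> P0; rewrite /static_weight (negPf (lift_path_neq P0)) lift_pathK transitE.
Qed.

Lemma lift_path_static P : P \in paths N -> (transit tau P < T)%N ->
  lift_path P \in paths (static_network N tau T).
Proof. by move=> PN PT; rewrite !inE imset_f ?orbT // inE PN. Qed.

Variant static_path_spec : {set option E} -> Prop :=
  | StaticNone : static_path_spec [set None]
  | StaticLift P of P \in paths N & (transit tau P < T)%N
      : static_path_spec (lift_path P).

Lemma static_pathP A : A \in paths (static_network N tau T) ->
  static_path_spec A.
Proof.
case/setU1P => [->|/imsetP[P]]; first exact: StaticNone.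
by rewrite inE => /andP[PN PT] ->; apply: StaticLift.
Qed.

(** Since [None] comes first on every path, [[set None]] always lies in the initial part of the
    first path and is a legitimate result of switching. *)
Lemma static_network_abstract : abstract_network (static_network N tau T).
Proof.
have [ne lin sw] := hN; split.
- move=> A /static_pathP[|P _ _]; apply/set0Pn; exists None; first exact: set11.
  exact: None_in_lift.
- move=> A /static_pathP[|P PN PT] /=.
    split.
    + by move=> a /set1P->.
    + by move=> a b /set1P-> /set1P->.
    + by move=> a b d /set1P-> /set1P->.
    + by move=> a b /set1P-> /set1P->.
  have [refl anti trans tot] := lin _ PN; split; rewrite lift_pathK.
  + by case=> [p|] //; rewrite Some_in_lift; apply: refl.
  + case=> [p|] [q|] //; rewrite !Some_in_lift => pP qP pq.
    by congr Some; apply: anti.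
  + case=> [p|] [q|] [s|] //; rewrite !Some_in_lift; exact: trans.
  + by case=> [p|] [q|] //; rewrite !Some_in_lift; exact: tot.
- move=> A B [e|] AN BN; last first.
    move=> _ /=; split=> //; apply/subsetP => b bB.
    by rewrite !inE bB orbT.
  case/static_pathP: AN => [|P PN PT]; first by rewrite !inE.
  case/static_pathP: BN => [|Q QN QT]; first by rewrite !inE /= andbF.
  rewrite inE !Some_in_lift => /andP[eP eQ] /=.
  rewrite !lift_pathK.
  have [|SN /subsetP Ssub] := sw P Q e PN QN; first by rewrite inE eP.
  have NoneIn : None \in [set p in lift_path P |
      match p with None => true | Some p => Defs.path_le N P p e end].
    by rewrite !inE.
  case: ifP => ST; last first.
    split; first exact: setU11.
    by rewrite sub1set in_setU NoneIn.
  split; first exact: lift_path_static.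
  apply/subsetP => -[p|_]; last by rewrite in_setU NoneIn.
  rewrite Some_in_lift => /Ssub /setUP[] /setIdP[pP le_p]; apply/setUP.
    by left; apply/setIdP; rewrite Some_in_lift.
  by right; apply/setIdP; rewrite Some_in_lift.
Qed.

Lemma static_weight_ge0 A : A \in paths (static_network N tau T) ->
  0 <= static_weight R tau T A.
Proof.
have [ne _ _] := hN.
case/static_pathP => [|P PN PT]; first by rewrite /static_weight eqxx.
by rewrite static_weight_lift ?ne // -transitE subr_ge0 ler_nat ltnW.
Qed.

Lemma static_weight_supermodular :
  supermodular (static_network N tau T) (static_weight R tau T).
Proof.
have [ne _ sw] := hN.
move=> A B [e|] AN BN; last by rewrite /= addrC.
case/static_pathP: AN => [|P PN PT]; first by rewrite !inE.
case/static_pathP: BN => [|Q QN QT]; first by rewrite !inE /= andbF.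
rewrite inE !Some_in_lift => /andP[eP eQ] /=; rewrite !lift_pathK.
(* Replacing a switched path that is too long by [[set None]] only raises the weight, from
   [T - tau <= 0] to 0. *)
have le_sw P' Q' : P' \in paths N -> Q' \in paths N -> e \in P' -> e \in Q' ->
  T%:R - \sum_(p in switch N P' e Q') (tau p)%:R <= static_weight R tau T
    (if (transit tau (switch N P' e Q') < T)%N
     then lift_path (switch N P' e Q') else [set None]).
  move=> PN' QN' eP' eQ'; have [|SN _] := sw P' Q' e PN' QN'; first by rewrite inE eP'.
  case: ltnP => ST; first by rewrite static_weight_lift ?ne.
  by rewrite /static_weight eqxx -transitE subr_le0 ler_nat.
have tau0 p : 0 <= (tau p)%:R :> R by [].
have := sum_switch hN tau0 PN QN eP eQ; have := sum_switch hN tau0 QN PN eQ eP.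
have := le_sw P Q PN QN eP eQ; have := le_sw Q P QN PN eQ eP.
rewrite !static_weight_lift ?ne //; lra.
Qed.

End StaticNetwork.

(** * Flows and cuts over time *)

Section OverTime.
Variables (R : realType) (E : finType) (N : network E).
Variables (c : E -> R) (tau : E -> nat) (T : nat).
Implicit Types (P Q : {set E}) (e f : E).

(** Sum the capacity constraints over [C]: every temporal path is counted at least once. *)
Lemma weak_duality_over_time (x : {set E * 'I_T} -> R) (C : {set E * 'I_T}) :
  flow_over_time N c tau x -> cut_over_time N tau C ->
  flow_value N tau x <= cut_capacity c C.
Proof.
move=> [x0 xc] hC; rewrite /flow_value /cut_capacity.
apply: le_trans (ler_sum _ (fun z _ => xc z.1 z.2)).
rewrite (exchange_big_dep (mem (temporal_paths N tau T))) /=; last first.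
  by move=> z A _ /andP[].
apply: ler_sum => A AN; have /set0Pn[z /setIP[zA zC]] := hC A AN.
rewrite (bigD1 z) /=; last by rewrite zC AN -surjective_pairing.
by rewrite lerDl sumr_ge0 // => *; apply: x0.
Qed.

Hypothesis hN : abstract_network N.

Lemma transit_before P e : e \in P ->
  (transit tau (before N P e) + tau e <= transit tau P)%N.
Proof.
move=> eP; rewrite -(ler_nat int) natrD !natr_sum.
exact: sum_before_path.
Qed.

Definition departures : {set {set E} * 'I_T} :=
  [set p : {set E} * 'I_T | (p.1 \in paths N) && (p.2 + transit tau p.1 < T)%N].

Lemma temporal_pathsE :
  temporal_paths N tau T =
    [set temporal_path N tau T p.1 p.2 | p : {set E} * 'I_T in departures].
Proof.
apply/setP => A; apply/imset2P/imsetP => [[P t PN]|[[P t]]].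
  by rewrite !inE => /= tT ->; exists (P, t); rewrite // inE PN tT.
by rewrite inE => /= /andP[PN tT] ->; exists P t; rewrite // !inE tT.
Qed.

(** Every element of [P] is reached before [T], so truncation to ['I_T] loses none. This is what
    lets [temporally_repeated] recover [P]. *)
Lemma temporal_path_fst P (t : nat) : (t + transit tau P < T)%N ->
  [set z.1 | z in temporal_path N tau T P t] = P.
Proof.
move=> tT; apply/setP => e; apply/imsetP/idP => [[z]|eP].
  by rewrite inE => /andP[zP _] ->.
have eT : (t + transit tau (before N P e) < T)%N.
  apply: leq_ltn_trans tT; rewrite leq_add2l.
  by apply: leq_trans (transit_before eP); apply: leq_addr.
by exists (e, Ordinal eT); rewrite // inE /= eP eqxx.
Qed.

(** The projection determines [P], and the arrival time at any one element then determines [t]. *)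
Lemma temporal_path_inj :
  {in departures &, injective
    (fun p : {set E} * 'I_T => temporal_path N tau T p.1 p.2)}.
Proof.
have [ne _ _] := hN.
move=> [P t] [Q u]; rewrite !inE /= => /andP[PN tT] /andP[QN uT] eq_tu.
have PQ : P = Q by rewrite -(temporal_path_fst tT) eq_tu temporal_path_fst.
subst Q; congr (_, _); apply: val_inj => /=.
have /set0Pn[e] := ne P PN; rewrite -{1}(temporal_path_fst tT).
case/imsetP => z zt _; have := zt; rewrite eq_tu; move: zt; rewrite !inE.
by move=> /andP[_ /eqP ->] /andP[_ /eqP/addIn].
Qed.

Lemma sum_static (F : {set option E} -> R) :
  \sum_(A in paths (static_network N tau T)) F A =
  F [set None] + \sum_(P in paths N | (transit tau P < T)%N) F (lift_path P).
Proof.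
have [ne _ _] := hN.
rewrite big_setU1 /=; last first.
  apply/imsetP => [[P]]; rewrite inE => /andP[PN _] /esym/eqP.
  by rewrite (negPf (lift_path_neq (ne P PN))).
rewrite big_imset /=; last by move=> P Q _ _; apply: (can_inj (@lift_pathK E)).
by congr (_ + _); apply: eq_bigl => P; rewrite inE.
Qed.

(** [B] is membership of [(e, theta)] for the capacity constraints and [xpredT] for the value. *)
Lemma sum_temporally_repeated (x : {set option E} -> R)
    (B : pred {set E * 'I_T}) :
  \sum_(A in temporal_paths N tau T | B A) temporally_repeated x A =
  \sum_(P in paths N | (transit tau P < T)%N) x (lift_path P) *+
    #|[set t : 'I_T | (t + transit tau P < T)%N & B (temporal_path N tau T P t)]|.
Proof.
rewrite temporal_pathsE big_mkcondr big_imset /=; last exact: temporal_path_inj.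
rewrite (eq_bigl (fun p : {set E} * 'I_T =>
  (p.1 \in paths N) && (p.2 + transit tau p.1 < T)%N)); last by move=> p; rewrite inE.
rewrite -big_mkcondr /=.
rewrite (eq_bigr (fun p : {set E} * 'I_T => x (lift_path p.1))); last first.
  move=> p /andP[/andP[_ pT] _].
  by rewrite /temporally_repeated temporal_path_fst.
(* The added condition [transit tau p.1 < T] follows from the departure condition; it makes the
   outer sum range as in [sum_static]. *)
rewrite (eq_bigl (fun p : {set E} * 'I_T => [&& p.1 \in paths N, (transit tau p.1 < T)%N &
    (p.2 + transit tau p.1 < T)%N && B (temporal_path N tau T p.1 p.2)])); last first.
  move=> p; rewrite -andbA; case: (p.1 \in paths N) => //=.
  case: (ltnP (p.2 + _)%N) => [lt|]; last by rewrite !andbF.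
  by rewrite (leq_ltn_trans _ lt) ?leq_addl.
under eq_bigl do rewrite andbA.
rewrite -(pair_big_dep (fun P => (P \in paths N) && (transit tau P < T)%N)
  (fun P (t : 'I_T) => (t + transit tau P < T)%N && B (temporal_path N tau T P t))
  (fun P _ => x (lift_path P))) /=.
by apply: eq_bigr => P _; rewrite -sumr_const; apply: eq_bigl => t; rewrite inE.
Qed.

(** For fixed [P], at most one departure time reaches [e] at time [th], so the load there is at most
    the static load of [Some e]. *)
Lemma temporally_repeated_flow (x : {set option E} -> R) :
  static_flow (static_network N tau T) (static_cap c) x ->
  flow_over_time N c tau (temporally_repeated x : {set E * 'I_T} -> R).
Proof.
move=> [x0 xc]; split=> [A|e th].
  rewrite temporal_pathsE => /imsetP[[P t]]; rewrite inE /= => /andP[PN tT] ->.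
  rewrite /temporally_repeated temporal_path_fst //; apply/x0/lift_path_static => //.
  by rewrite (leq_ltn_trans _ tT) ?leq_addl.
rewrite sum_temporally_repeated; apply: le_trans (xc (Some e)).
rewrite [leRHS]big_mkcondr sum_static in_set1 /= add0r; apply: ler_sum => P /andP[PN PT].
have xP := x0 _ (lift_path_static PN PT); rewrite Some_in_lift; case: ifP => eP.
  rewrite -[leRHS]mulr1n ler_wpMn2l //; apply/card_le1_eqP => t u.
  rewrite !inE eP /= => /andP[_ /eqP et] /andP[_ /eqP eu].
  by apply/val_inj/eqP; rewrite -(eqn_add2r (transit tau (before N P e))) -et eu.
by rewrite eq_card0 ?mulr0n // => t; rewrite !inE eP andbF.
Qed.

Lemma card_departures P : (transit tau P < T)%N ->
  #|[set t : 'I_T | (t + transit tau P < T)%N]| = (T - transit tau P)%N.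
Proof.
move=> PT; rewrite -[RHS]card_ord -sum1_card -[RHS]sum1_card.
rewrite (big_ord_widen _ (fun=> 1%N) (leq_subr (transit tau P) T)).
by apply: eq_bigl => t; rewrite inE ltn_subRL addnC.
Qed.

Lemma temporally_repeated_value (x : {set option E} -> R) :
  flow_value N tau (temporally_repeated x : {set E * 'I_T} -> R) =
  static_value (static_network N tau T) (static_weight R tau T) x.
Proof.
have [ne _ _] := hN.
rewrite /flow_value /static_value sum_static /static_weight eqxx mul0r add0r.
have := sum_temporally_repeated x xpredT.
under eq_bigl do rewrite andbT; move=> ->; apply: eq_bigr => P /andP[PN PT].
rewrite (negPf (lift_path_neq (ne P PN))) lift_pathK -natrB ?(ltnW PT) //.
rewrite -card_departures // mulr_natl; congr (_ *+ _).
by apply: eq_card => t; rewrite !inE andbT.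
Qed.

End OverTime.

(** * The threshold cut: covering and counting *)

Section ThresholdCut.
Variables (R : realType) (E : finType) (N : network E).
Variables (tau : E -> nat) (T : nat) (y : option E -> R).
Implicit Types (P Q : {set E}) (e f : E).
Hypothesis hN : abstract_network N.
Hypothesis y_cut : static_cut (static_network N tau T) (static_weight R tau T) y.
Hypothesis y_None : y None = 0.

Let len e : R := (tau e)%:R + y (Some e).

Lemma len_ge0 e : 0 <= len e.
Proof. by rewrite addr_ge0 // y_cut.2. Qed.

(** Paths absent from the static instance are included, since their transit time alone reaches [T];
    switching may produce them. *)
Lemma length_ge P : P \in paths N -> T%:R <= \sum_(e in P) len e.
Proof.
have [ne _ _] := hN; have [yr y0] := y_cut.
move=> PN; rewrite big_split /=; have [PT|] := ltnP (transit tau P) T.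
  have := yr _ (lift_path_static PN PT).
  by rewrite sum_lift y_None add0r static_weight_lift ?ne // lerBlDl.
by rewrite -(ler_nat R) transitE => /le_trans; apply; rewrite lerDl sumr_ge0.
Qed.

(* If [P_t] avoids the cut, let [e] be the last element of [P] at which [P_t]
   arrives too late, as witnessed by [Q]. Then [Q x_e P] is either too short, or
   its first element on [P] beyond [e] is again reached too late. *)
Lemma threshold_cut_covers : cut_over_time N tau (threshold_cut N tau T y).
Proof.
move=> A; rewrite temporal_pathsE => /imsetP[[P t]]; rewrite inE /=.
move=> /andP[PN tT] ->; apply/set0Pn.
have [ne lin sw] := hN.
pose theta e := (t + transit tau (before N P e))%N.
have thetaT e : e \in P -> (theta e + tau e <= t + transit tau P)%N.
  by move=> eP; rewrite -addnA leq_add2l transit_before.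
pose late e := [exists Q in paths N,
  (e \in Q) && (delay N tau y Q e + y (Some e) <= (theta e)%:R)].
pose reached e := [exists Q in paths N,
  (e \in Q) && (delay N tau y Q e <= (theta e)%:R)].
(* An element reached but not late is in the cut at its arrival time. Otherwise every reached
   element is late. *)
case: (pickP [pred e in P | reached e && ~~ late e]) => [e|none] /=.
  move=> /and3P[eP re nle].
  have eT : (theta e < T)%N.
    by apply: leq_ltn_trans tT; apply: leq_trans (thetaT e eP); apply: leq_addr.
  exists (e, Ordinal eT); rewrite !inE /= eP eqxx /=; apply/andP; split=> //.
  apply/forall_inP => Q QN; apply/implyP => eQ; rewrite ltNge.
  by apply: contra nle => le; apply/exists_inP; exists Q; rewrite ?eQ.
have {}none e Q : e \in P -> Q \in paths N -> e \in Q ->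
    delay N tau y Q e <= (theta e)%:R -> late e.
  move=> eP QN eQ le; have := none e; rewrite /= eP /=.
  have -> : reached e by apply/exists_inP; exists Q; rewrite ?eQ.
  by move=> /negbFE.
pose S := [set e in P | late e].
have SP : S \subset P by apply/subsetP => e; rewrite inE => /andP[].
(* The first element of [P] has delay 0 along [P], hence is reached. *)
have S0 : S != set0.
  have [e eP bef] := before_first hN PN; apply/set0Pn; exists e.
  by rewrite inE eP (none e P) // /delay bef big_set0.
have [e eS emax] := linear_order_min (linear_order_converse (lin _ PN)) SP S0.
have := eS; rewrite inE => /andP[eP /exists_inP[Q QN /andP[eQ leQ]]].
have [|WN _] := sw Q P e QN PN; first by rewrite inE eQ.
have Wsub := switch_sub hN QN PN eQ eP.
set W := switch N Q e P in WN Wsub.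
have uptoQ : \sum_(p in e |: before N Q e) len p <= (theta e + tau e)%:R.
  by rewrite sum_upto natrD /len addrCA addrC lerD2r.
pose X := W :\: (e |: before N Q e).
(* If [X] is empty, [W] has length at most [theta e + tau e <= t + transit tau P < T], against
   [length_ge]. *)
have [X0|X0] := eqVneq X set0.
  have WQ : W \subset e |: before N Q e by rewrite -setD_eq0 -/X X0.
  have := le_trans (length_ge WN) (le_trans (sumr_subset len_ge0 WQ) uptoQ).
  rewrite ler_nat => /leq_trans/(_ (thetaT e eP)).
  by rewrite leqNgt tT.
(* Whatever the order of [W], all that precedes [f] on it lies in [e |: before N Q e]. So its delay
   at [f] is at most [theta e + tau e <= theta f], and [f] is late although beyond [e]. *)
have [f fX fmin] := linear_order_min (lin _ WN) (subsetDl _ _) X0.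
have := fX; rewrite in_setD in_setU1 negb_or => /andP[/andP[fe fQ] fW].
have := subsetP Wsub f fW; rewrite in_setU (negPf fQ) /= inE => /andP[nbf fP].
have [_ anti _ tot] := lin _ PN.
have lef : Defs.path_le N P e f.
  by have := tot e f eP fP; move: nbf; rewrite inE fP fe /= => /negPf->; rewrite orbF.
have before_f : before N W f \subset e |: before N Q e.
  apply/subsetP => p; rewrite inE => /and3P[pW pf lpf].
  apply/negPn/negP => npQ; have pX : p \in X by rewrite in_setD npQ.
  have [_ antiW _ _] := lin _ WN.
  by case/eqP: pf; apply: antiW => //; rewrite lpf fmin.
suff : late f.
  move=> lf; have fS : f \in S by rewrite inE fP.
  by case/eqP: fe; apply: anti => //; rewrite lef emax.
apply: (none f W) => //; apply: le_trans (sumr_subset len_ge0 before_f) _.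
apply: le_trans uptoQ _; rewrite ler_nat -addnA leq_add2l.
rewrite -(ler_nat R) natrD !transitE; apply: sum_before_lt => //.
by rewrite eq_sym.
Qed.

(** A smaller delay along [Q] would make [switch N Q e P] shorter than [T]. *)
Lemma tight_delay_min P Q e : P \in paths N -> Q \in paths N -> e \in P ->
  e \in Q -> \sum_(p in P) len p = T%:R ->
  delay N tau y P e <= delay N tau y Q e.
Proof.
move=> PN QN eP eQ tight.
have [_ _ sw] := hN; have [|WN _] := sw Q P e QN PN; first by rewrite inE eQ.
have := sum_switch hN len_ge0 QN PN eQ eP; rewrite tight.
have := length_ge WN; rewrite /delay -/len; lra.
Qed.

(* A tight path meets the cut at [(e, theta)] only if [theta] minus the transit
   time of [before N P e] lies in the interval of length [y e] starting at the
   sum of [y] over [before N P e]; along [P] these intervals are disjoint and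
   fill [0, T - transit P). *)
Lemma threshold_cut_tight P : P \in paths N ->
  (transit tau P < T)%N -> \sum_(p in P) len p = T%:R ->
  (#|[set z in threshold_cut N tau T y | z.1 \in P]| <= T - transit tau P)%N.
Proof.
move=> PN PT tight; have [_ lin _] := hN; have [_ tauy] := y_cut.
pose Y e := \sum_(p in before N P e) y (Some p).
have y0 e : 0 <= y (Some e) by [].
(* The departure time of the copy of [P] through [z]; [startP] shows that the subtraction does not
   truncate on [S]. *)
pose start (z : E * 'I_T) := (z.2 - transit tau (before N P z.1))%N.
have delayE e :
    delay N tau y P e = (transit tau (before N P e))%:R + Y e.
  by rewrite /delay big_split /= transitE.
set S := [set z in threshold_cut N tau T y | z.1 \in P].
have startP z : z \in S ->
  [/\ z.1 \in P, (transit tau (before N P z.1) <= z.2)%N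
    & Y z.1 <= (start z)%:R < Y z.1 + y (Some z.1)].
  case: z => e th; rewrite !inE /= => /andP[/andP[/exists_inP[Q QN]]].
  move=> /andP[eQ leQ] /forall_inP/(_ P PN) /implyP ltP eP.
  have := le_trans (tight_delay_min PN QN eP eQ tight) leQ.
  have := ltP eP; rewrite delayE /start /= => lt_th le_th.
  have Y0 : 0 <= Y e by apply: sumr_ge0.
  have th_ge : (transit tau (before N P e) <= th)%N.
    by rewrite -(ler_nat R); lra.
  by split=> //; rewrite natrB //; apply/andP; split; lra.
have disj e f (s : R) : e \in P -> f \in P -> e != f -> Defs.path_le N P e f ->
    s < Y e + y (Some e) -> Y f <= s -> False.
  move=> eP fP ef lef lts les; have := sum_before_lt hN y0 PN eP fP ef lef.
  by rewrite -/(Y e) -/(Y f) => /le_trans/(_ les)/le_lt_trans/(_ lts); rewrite ltxx.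
have inj : {in S &, injective start}.
  move=> z w zS wS eq_zw.
  have [zP lez /andP[Yz zY]] := startP z zS.
  have [wP lew /andP[Yw wY]] := startP w wS.
  have [_ _ _ tot] := lin _ PN.
  have eq1 : z.1 = w.1.
    have [//|zw] := eqVneq z.1 w.1; have /orP[lzw|lwz] := tot _ _ zP wP; exfalso.
      by apply: (disj _ _ _ zP wP zw lzw zY); rewrite eq_zw.
    by apply: (disj _ _ _ wP zP _ lwz wY); rewrite -?eq_zw // eq_sym.
  apply: injective_projections => //; apply: val_inj => /=.
  rewrite -(subnK lez) -(subnK lew) -eq1; congr (_ + _)%N.
  by move: eq_zw; rewrite /start -eq1.
(* [start] injects [S] into the integers below [T - transit tau P], which by tightness is the total
   of [y] on [P]. *)
rewrite cardE -(size_map start) -(size_iota 0 (T - transit tau P)).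
apply: uniq_leq_size => [|s /mapP[z]].
  by rewrite map_inj_in_uniq ?enum_uniq // => z w; rewrite !mem_enum; apply: inj.
rewrite mem_enum mem_iota /= add0n => /startP[zP _ /andP[_ zY]] ->.
rewrite -(ltr_nat R) (natrB R (ltnW PT)) transitE -tight big_split /= addrAC subrr add0r.
exact: lt_le_trans zY (sum_before_path N y0 zP).
Qed.

End ThresholdCut.

(** * Optimality of the two constructions *)

Lemma threshold_cut_capacity (R : realType) (E : finType) (N : network E)
    (c : E -> R) (tau : E -> nat) (T : nat) (x : {set option E} -> R)
    (y : option E -> R) :
  abstract_network N -> (forall e, 0 <= c e) ->
  static_flow (static_network N tau T) (static_cap c) x ->
  static_cut (static_network N tau T) (static_weight R tau T) y ->
  static_value (static_network N tau T) (static_weight R tau T) x =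
    static_capacity (static_cap c) y ->
  y None = 0 ->
  cut_capacity c (threshold_cut N tau T y) <=
    static_value (static_network N tau T) (static_weight R tau T) x.
Proof.
move=> hN c0 x_flow y_cut xy yN; have [ne _ _] := hN.
have [sat tight] := complementary_slackness x_flow y_cut xy.
have [x0 xc] := x_flow.
(* A cut element has a nonempty interval, so [y] is positive there and slackness replaces its
   capacity by its flow. Exchanging the sums, each path with flow is counted at most as often as its
   weight. *)
rewrite /cut_capacity (eq_bigr (fun z : E * 'I_T =>
  \sum_(A in paths (static_network N tau T) | Some z.1 \in A) x A)); last first.
  case=> e th; rewrite inE /= => /andP[/exists_inP[Q QN /andP[eQ leQ]]].
  move=> /forall_inP/(_ Q QN)/implyP/(_ eQ) /(le_lt_trans leQ).
  by rewrite ltrDl => /sat.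
rewrite (exchange_big_dep (mem (paths (static_network N tau T)))) /=; last first.
  by move=> z A _ /andP[].
apply: ler_sum => A AN; under eq_bigl do rewrite AN /=.
rewrite sumr_const mulrC -mulr_natr.
have := x0 A AN; rewrite le_eqVlt => /predU1P[<-|xA]; first by rewrite !mul0r.
rewrite ler_pM2l //.
have tightA := tight A AN xA; case/static_pathP: AN tightA => [_|P PN PT].
  by rewrite /static_weight eqxx eq_card0 // => z; rewrite unfold_in /= in_set1 andbF.
rewrite sum_lift yN add0r static_weight_lift ?ne // => tightA.
rewrite -transitE -natrB ?(ltnW PT) // ler_nat.
apply: leq_trans (threshold_cut_tight hN y_cut yN PN PT _).
  by apply/eq_leq/eq_card => z; rewrite [LHS]unfold_in Some_in_lift [RHS]in_set.
by rewrite big_split /= tightA addrC subrK.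
Qed.

(* The capacity of [None] exceeds the total flow through [E], so it is slack once
   the useless path [{None}] carries no flow. *)
Lemma min_weighted_cut_None (R : realType) (E : finType) (N : network E)
    (c : E -> R) (tau : E -> nat) (T : nat) (x : {set option E} -> R)
    (y : option E -> R) :
  abstract_network N -> (forall e, 0 <= c e) ->
  static_flow (static_network N tau T) (static_cap c) x ->
  static_cut (static_network N tau T) (static_weight R tau T) y ->
  static_value (static_network N tau T) (static_weight R tau T) x =
    static_capacity (static_cap c) y ->
  y None = 0.
Proof.
move=> hN c0 [x0 xc] y_cut xy; have [ne _ _] := hN.
(* Dropping the flow on the weightless path keeps the value, so slackness still applies. *)
pose x' A := if A == [set None] then 0 else x A.
have x'0 A : A \in paths (static_network N tau T) -> 0 <= x' A.
  by rewrite /x'; case: eqP => // _ /x0.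
have x'x A : A \in paths (static_network N tau T) -> x' A <= x A.
  by rewrite /x'; case: eqP => // _ /x0.
have x'c e : \sum_(A in paths (static_network N tau T) | e \in A) x' A <= static_cap c e.
  by apply: le_trans (xc e); apply: ler_sum => A /andP[/x'x].
have x'v : static_value (static_network N tau T) (static_weight R tau T) x' =
    static_capacity (static_cap c) y.
  rewrite -xy; apply: eq_bigr => A _; rewrite /x' /static_weight.
  by case: ifP; rewrite ?mul0r ?mulr0.
have [sat _] := complementary_slackness (conj x'0 x'c) y_cut x'v.
(* If [y None > 0], then [None] is saturated by [x']; but each path carrying [x'] also uses some
   [Some e], so the total is at most the sum of [c]. *)
have [_ /(_ None)] := y_cut; rewrite le_eqVlt => /predU1P[<-//|/sat].
rewrite big_mkcondr sum_static // /x' eqxx if_same add0r => sum_x.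
suff : 1 + \sum_e c e <= \sum_e c e by rewrite gerDr ler10.
rewrite -[leLHS]/(static_cap c None) -sum_x.
apply: le_trans (ler_sum _ (fun e _ => x'c (Some e))).
rewrite (exchange_big_dep (mem (paths (static_network N tau T)))) /=; last first.
  by move=> e A _ /andP[].
rewrite sum_static // -[leLHS]add0r lerD //.
  by rewrite sumr_ge0 // => e _; apply: x'0; apply: setU11.
apply: ler_sum => P /andP[PN PT].
have PS := lift_path_static PN PT; have /set0Pn[e eP] := ne P PN.
rewrite None_in_lift -/(x' (lift_path P)) (bigD1 e) /= ?PS ?Some_in_lift //.
by rewrite lerDl sumr_ge0 // => _ _; apply: x'0.
Qed.

Lemma static_cap_ge0 (R : realType) (E : finType) (c : E -> R) (a : option E) :
  (forall e, 0 <= c e) -> 0 <= static_cap c a.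
Proof. by move=> c0; case: a => [e|] //=; rewrite addr_ge0 ?sumr_ge0. Qed.

(** Optimality enters only as equality of values, so any optimal flow can be paired with one fixed
    optimal cut, and conversely. *)
Lemma reduction_optimal (R : realType) (E : finType) (N : network E)
    (c : E -> R) (tau : E -> nat) (T : nat) (x : {set option E} -> R)
    (y : option E -> R) :
  abstract_network N -> (forall e, 0 <= c e) ->
  static_flow (static_network N tau T) (static_cap c) x ->
  static_cut (static_network N tau T) (static_weight R tau T) y ->
  static_value (static_network N tau T) (static_weight R tau T) x =
    static_capacity (static_cap c) y ->
  [/\ max_flow_over_time N c tau (temporally_repeated x : {set E * 'I_T} -> R),
      min_cut_over_time N c tau (threshold_cut N tau T y)
    & flow_value N tau (temporally_repeated x : {set E * 'I_T} -> R) =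
        cut_capacity c (threshold_cut N tau T y)].
Proof.
move=> hN c0 x_flow y_cut xy.
have yN := min_weighted_cut_None hN c0 x_flow y_cut xy.
have xT := temporally_repeated_flow hN x_flow.
have yT := threshold_cut_covers hN y_cut yN.
have val : flow_value N tau (temporally_repeated x : {set E * 'I_T} -> R) =
    cut_capacity c (threshold_cut N tau T y).
  apply/eqP; rewrite eq_le (weak_duality_over_time xT yT) temporally_repeated_value //.
  exact: threshold_cut_capacity.
split=> //.
  by split=> // x' x'T; rewrite val; apply: weak_duality_over_time.
by split=> // C CT; rewrite -val; apply: weak_duality_over_time.
Qed.

Theorem theorem2 (R : realType) (E : finType) (N : network E)
    (c : E -> R) (tau : E -> nat) (T : nat)
    (hN : abstract_network N) (hc : forall e, 0 <= c e) :
  (exists (x : {set E * 'I_T} -> R) (C : {set E * 'I_T}),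
     [/\ max_flow_over_time N c tau x, min_cut_over_time N c tau C
       & flow_value N tau x = cut_capacity c C]) /\
  (let N' := static_network N tau T in
   let c' := static_cap c in
   let r' := static_weight R tau T in
   [/\ weighted_flow_instance N' c' r',
       exists x, max_weighted_flow N' c' r' x,
       exists y, min_weighted_cut N' c' r' y,
       forall x, max_weighted_flow N' c' r' x ->
         max_flow_over_time N c tau (temporally_repeated x : {set E * 'I_T} -> R)
     & forall y, min_weighted_cut N' c' r' y ->
         min_cut_over_time N c tau (threshold_cut N tau T y)]).
Proof.
have hN' := static_network_abstract tau T hN; have [ne _ _] := hN'.
have hc' a : 0 <= static_cap c a by apply: static_cap_ge0.
have [x [y [xf yc xy]]] := strong_duality (static_weight R tau T) ne hc'.
split.
  by exists (temporally_repeated x), (threshold_cut N tau T y); apply: reduction_optimal.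
split.
- by split=> //; [apply: static_weight_ge0 | apply: static_weight_supermodular].
- by exists x; split=> // x' x'f; rewrite xy; apply: weak_duality.
- by exists y; split=> // y' y'c; rewrite -xy; apply: weak_duality.
- move=> x' [x'f x'max].
  have x'y : static_value (static_network N tau T) (static_weight R tau T) x' =
      static_capacity (static_cap c) y.
    by apply/eqP; rewrite eq_le weak_duality // -xy x'max.
  by have [] := reduction_optimal hN hc x'f yc x'y.
- move=> y' [y'c y'min].
  have xy' : static_value (static_network N tau T) (static_weight R tau T) x =
      static_capacity (static_cap c) y'.
    by apply/eqP; rewrite eq_le weak_duality // xy y'min.
  by have [] := reduction_optimal hN hc xf y'c xy'.
Qed.
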